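(* In the edge-distinguishing game (EDGe) played on the cycle $C_7$ (with $\lambda(C_7)$ colors), Player 2 has a winning strategy.
   Context: $C_n$ is the cycle on $n$ vertices. For a positive integer $k$ let $[k]=\{1,\dots,k\}$. A $k$-coloring $c:V(G)\to[k]$ induces $c'(\{u,v\})=\{c(u),c(v)\}$ (a multiset); $c$ is edge-distinguishing if $c'$ is injective, and $\lambda(G)$ is the least $k$ admitting such a coloring. A partial coloring on $U\subseteq V(G)$ has partial induced edge coloring on $G[U]$. EDGe on $G$: two players, Player 1 first, alternately color an uncolored vertex with a color from $[\lambda(G)]$; a move is legal iff afterwards the partial induced edge coloring of the colored vertices is injective. The player making the last legal move wins. A winning strategy guarantees a win regardless of the opponent's play. *)

(* Defs.v *)
From HB Require Import structures.
From mathcomp Require Import all_boot all_order.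
From mathcomp Require Import finmap multiset.

Set Implicit Arguments.
Unset Strict Implicit.
Unset Printing Implicit Defensive.

Local Open Scope mset_scope.

Record sgraph := SGraph {
  vertex :> finType;
  adj : rel vertex;
  adj_sym : symmetric adj;
  adj_irrefl : irreflexive adj
}.

(* For n >= 3 the condition u != v is redundant and this is the cycle C_n;
   it only keeps the relation irreflexive in the degenerate case n = 1. *)
Definition cycle_adj (n : nat) : rel 'I_n :=
  fun u v => (u != v) && ((v == ordS u) || (u == ordS v)).

Lemma cycle_adj_sym n : symmetric (@cycle_adj n).
Proof. by move=> u v; rewrite /cycle_adj eq_sym orbC. Qed.

Lemma cycle_adj_irrefl n : irreflexive (@cycle_adj n).
Proof. by move=> u; rewrite /cycle_adj eqxx. Qed.

Definition cycle_graph (n : nat) : sgraph :=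
  SGraph (@cycle_adj_sym n) (@cycle_adj_irrefl n).

Definition edges (G : sgraph) : {set {set G}} :=
  [set [set uv.1; uv.2] | uv : G * G & adj uv.1 uv.2].

Section EdgeDistinguishing.
Variable G : sgraph.

(* The color set {1, ..., k} is represented by 'I_k. *)
Definition coloring (k : nat) := {ffun G -> 'I_k}.

Definition induced_edge_coloring k (c : coloring k) (e : {set G}) :
    {mset 'I_k} := seq_mset [seq c x | x <- enum e].

Lemma induced_edge_coloring2 k (c : coloring k) (u v : G) : u != v ->
  induced_edge_coloring c [set u; v] = [mset c u; c v].
Proof.
move=> uv; have p : perm_eq (enum [set u; v]) [:: u; v].
  apply: uniq_perm; rewrite ?enum_uniq //= ?inE ?uv //.
  by move=> x; rewrite mem_enum !inE.
rewrite /induced_edge_coloring.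
have /eq_seq_msetP-> := perm_map c p.
by apply/msetP=> x; rewrite mset_seqE mset1DE msetnE /= addn0 ![x == _]eq_sym.
Qed.

Definition edge_distinguishing k (c : coloring k) : bool :=
  dinjectiveb (induced_edge_coloring c) (mem (edges G)).

Definition edge_distinguishable (k : nat) : bool :=
  (0 < k) && [exists c : coloring k, edge_distinguishing c].

Lemma ex_edge_distinguishable : exists k, edge_distinguishable k.
Proof.
exists #|G|.+1; apply/existsP.
pose f (x : G) : 'I_#|G|.+1 := widen_ord (leqnSn _) (enum_rank x).
have fI : injective f.
  by move=> x y /(congr1 val)/= /val_inj/enum_rank_inj.
exists [ffun x => f x]; apply/dinjectiveP=> e1 e2 _ _ /eq_seq_msetP/perm_mem H.
apply/setP=> x; have := H (f x).
rewrite !(eq_map (ffunE _)) !mem_map // !mem_enum.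
by [].
Qed.

Definition lambda : nat := ex_minn ex_edge_distinguishable.

(* A partial coloring; the set U of colored vertices is [colored p]. *)
Definition pcoloring (k : nat) := {ffun G -> option 'I_k}.

Definition colored k (p : pcoloring k) : {set G} := [set v | p v != None].

Definition induced_edges (U : {set G}) : {set {set G}} :=
  [set e in edges G | e \subset U].

Definition partial_edge_coloring k (p : pcoloring k) (e : {set G}) :
    {mset 'I_k} := seq_mset (pmap p (enum e)).

Definition partial_edge_distinguishing k (p : pcoloring k) : bool :=
  dinjectiveb (partial_edge_coloring p) (mem (induced_edges (colored p))).

End EdgeDistinguishing.

Inductive player := Player1 | Player2.

Section Game.
Variable G : sgraph.
Variable k : nat.

Definition move : Type := G * 'I_k.

Definition play := seq move.

Definition color_vertex (p : pcoloring G k) (m : move) : pcoloring G k :=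
  [ffun v => if v == m.1 then Some m.2 else p v].

Definition legal_move (p : pcoloring G k) (m : move) : bool :=
  (p m.1 == None) && partial_edge_distinguishing (color_vertex p m).

Definition start : pcoloring G k := [ffun=> None].

Definition position (s : play) : pcoloring G k := foldl color_vertex start s.

Fixpoint legal_from (p : pcoloring G k) (s : play) : bool :=
  if s is m :: s' then legal_move p m && legal_from (color_vertex p m) s'
  else true.

Definition legal_play (s : play) : bool := legal_from start s.

Definition completed (s : play) : Prop :=
  forall m : move, ~~ legal_move (position s) m.

Definition to_move (s : play) : player :=
  if odd (size s) then Player2 else Player1.

Definition made_last_move (P : player) (s : play) : Prop :=
  exists (s' : play) (m : move), s = rcons s' m /\ to_move s' = P.

Definition strategy := play -> move.

Definition follows (P : player) (sigma : strategy) (s : play) : Prop :=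
  forall (s1 : play) (m : move) (s2 : play),
    s = s1 ++ m :: s2 -> to_move s1 = P -> m = sigma s1.

(* The first conjunct forces the strategy to answer with a legal move whenever
   one exists: an illegal answer would leave the play unfinished, so that it
   would not be constrained by the second conjunct. *)
Definition winning_strategy (P : player) (sigma : strategy) : Prop :=
  forall s : play, legal_play s -> follows P sigma s ->
    (to_move s = P -> (exists m : move, legal_move (position s) m) ->
       legal_move (position s) (sigma s)) /\
    (completed s -> made_last_move P s).

End Game.

Definition EDGe_has_winning_strategy (G : sgraph) (P : player) : Prop :=
  exists sigma : strategy G (lambda G), winning_strategy P sigma.

(* Main.v *)
Require Import Defs.
From mathcomp Require Import all_boot.
From mathcomp Require Import finmap multiset zify.

(** Seven edges need seven distinct multisets of colors, so three colors (six
    multisets) are not enough, while the coloring 0011223 of [C_7] shows that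
    [lambda C_7 = 4].  The game with four colors is then solved by exhaustive
    search: every move of Player 1 has a reply after which Player 1 is lost
    again.  The search runs on positions written as sequences of optional
    numbers, where an edge is labelled by the sorted pair of its end colors. *)

Set Implicit Arguments.
Unset Strict Implicit.
Unset Printing Implicit Defensive.

(** * Lost positions and strategies on an arbitrary graph *)

Section WinningStrategies.
Variables (G : sgraph) (k : nat).
Implicit Types (p : pcoloring G k) (m : Defs.move G k) (s : play G k).

(* At depth 0 the answer is [false], so that [lost n p] never depends on [n]
   being large enough: it always certifies a loss of the player to move. *)
Fixpoint lost (n : nat) p : bool :=
  if n is n'.+1 then
    [forall m, legal_move p m ==>
      [exists m', legal_move (color_vertex p m) m' &&
                  lost n' (color_vertex (color_vertex p m) m')]]
  else false.

Lemma lostS n p : lost n p -> lost n.+1 p.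
Proof.
elim: n p => // n IHn p /forallP lost_p; apply/forallP=> m.
apply/implyP=> /(implyP (lost_p m))/existsP[m' /andP[legal_m' lost_m']].
by apply/existsP; exists m'; apply/andP; split=> //; apply: IHn.
Qed.

(** Since [lost] is monotone in the depth, the same [n] serves before and after a round, and the
    strategy need not count moves. *)
Lemma lost_reply n p m : lost n p -> legal_move p m ->
  exists m', legal_move (color_vertex p m) m' &&
             lost n (color_vertex (color_vertex p m) m').
Proof.
move=> lost_p legal_m.
by have /forallP/(_ m)/implyP/(_ legal_m)/existsP := lostS lost_p.
Qed.

Lemma position_rcons s m :
  position (rcons s m) = color_vertex (position s) m.
Proof. by rewrite /position -cats1 foldl_cat. Qed.

Lemma legal_play_rcons s m :
  legal_play (rcons s m) = legal_play s && legal_move (position s) m.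
Proof.
rewrite /legal_play /position; elim: s (start G k) => [|x s IHs] p /=.
  by rewrite andbT.
by rewrite IHs andbA.
Qed.

Lemma follows_rcons (P : player) (sigma : strategy G k) s m :
  follows P sigma (rcons s m) ->
  follows P sigma s /\ (to_move s = P -> m = sigma s).
Proof.
move=> fol; split=> [s1 x s2 def_s|]; last by apply: (fol s m [::]); rewrite cats1.
by apply: (fol s1 x (rcons s2 m)); rewrite def_s rcons_cat.
Qed.

Lemma to_move_rcons s m :
  to_move (rcons s m) = if to_move s is Player1 then Player2 else Player1.
Proof. by rewrite /to_move size_rcons /=; case: (odd _). Qed.

(** Along legal plays that follow [sigma], the position is lost when Player 1 is to move, and Player
    2 has a [good] reply otherwise. So a completed play stops at a turn of Player 1; [legal_m0]
    rules out the empty play, which has no last move. *)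
Lemma lost_start_winning_strategy n m0 :
    legal_move (start G k) m0 -> lost n (start G k) ->
  exists sigma : strategy G k, winning_strategy Player2 sigma.
Proof.
move=> legal_m0 lost_start.
pose good p m := legal_move p m && lost n (color_vertex p m).
(* Without a good reply any legal move is taken, so the answer is legal whenever a legal move
   exists; [m0] is the default value. *)
pose sigma s := let p := position s in
  odflt (odflt m0 [pick m | legal_move p m]) [pick m | good p m].
have inv s : legal_play s -> follows Player2 sigma s ->
    if to_move s is Player1 then is_true (lost n (position s))
    else exists m, good (position s) m.
  elim/last_ind: s => // s m IHs.
  rewrite legal_play_rcons => /andP[legal_s legal_m] /follows_rcons[fol_s fol_m].
  have := IHs legal_s fol_s; rewrite to_move_rcons position_rcons.
  case to_s: (to_move s); first by move/lost_reply/(_ legal_m).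
  case=> m1 good_m1; rewrite (fol_m to_s) /sigma.
  by case: (pickP (good (position s))) => [m2 /andP[]//|/(_ m1)/negbT/negP[]].
exists sigma => s legal_s fol_s; split=> [_ [m legal_m]|done_s].
  rewrite /sigma; case: (pickP (good (position s))) => [m2 /andP[]//|_] /=.
  by case: pickP => [//|/(_ m)/negbT/negP[]].
have := inv s legal_s fol_s; case to_s: (to_move s) => /=; last first.
  by case=> m /andP[legal_m _]; have := done_s m; rewrite legal_m.
move=> _; elim/last_ind: s => [|s m _] in done_s to_s legal_s fol_s *.
  by have := done_s m0; rewrite legal_m0.
by exists s, m; move: to_s; rewrite to_move_rcons; case: (to_move s).
Qed.

End WinningStrategies.

(** * Edges of a cycle, indexed by their first vertex *)

Section CycleEdges.
Variable n : nat.
Let C := cycle_graph n.+3.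
Implicit Type i : 'I_n.+3.

Definition cycle_edge i : {set C} := [set i; ordS i].

Lemma ordS_neq i : ordS i != i.
Proof.
rewrite -val_eqE /=; have := ltn_ord i; rewrite leq_eqVlt => /predU1P[[->]|lt_i].
  by rewrite modnn.
by rewrite modn_small // gtn_eqF.
Qed.

(** Length at least 3 matters here: on two vertices the edges starting at [i] and at [ordS i] would
    coincide, and [cycle_edge] would not be injective. *)
Lemma ordSS_neq i : ordS (ordS i) != i.
Proof.
rewrite -val_eqE; case: i => i /= lt_i.
have [->|i_max] := eqVneq i n.+2; first by rewrite modnn modn_small.
have lt_i1 : i.+1 < n.+3 by lia.
rewrite (modn_small lt_i1); have [->|i_max1] := eqVneq i n.+1.
  by rewrite modnn.
by rewrite modn_small; lia.
Qed.

Lemma cycle_edge_inj : injective cycle_edge.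
Proof.
move=> i j eq_ij; have: i \in cycle_edge j by rewrite -eq_ij set21.
rewrite !inE => /orP[/eqP//|/eqP i_Sj].
have: ordS i \in cycle_edge j by rewrite -eq_ij set22.
rewrite i_Sj !inE (negPf (ordSS_neq j)) /= => /eqP/ordS_inj Sj_j.
by move/eqP: (ordS_neq j).
Qed.

Lemma edges_cycleE : edges C = cycle_edge @: [set: 'I_n.+3].
Proof.
apply/setP=> e; apply/imsetP/imsetP=> [[[u v]]|[i _ ->]].
  rewrite inE /= /cycle_adj => /andP[_ /orP[] /eqP-> ->].
    by exists u; rewrite ?inE.
  by exists v; rewrite ?inE // setUC.
exists (i, ordS i) => //=.
by rewrite inE /= /cycle_adj eqxx eq_sym ordS_neq.
Qed.

Lemma perm_enum_cycle_edge i : perm_eq (enum (cycle_edge i)) [:: i; ordS i].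
Proof.
apply: uniq_perm; first exact: enum_uniq.
  by rewrite /= !inE eq_sym ordS_neq.
by move=> x; rewrite mem_enum !inE.
Qed.

End CycleEdges.

(** * Computable labels of edges *)

Definition edge_label (ab : option nat * option nat) : option (nat * nat) :=
  if ab is (Some a, Some b) then Some (minn a b, maxn a b) else None.

(* The entry at [i] and its cyclic successor are the ends of the edge [i]. *)
Definition edge_labels (t : seq (option nat)) : seq (nat * nat) :=
  pmap edge_label (zip t (rot 1 t)).

Lemma perm_eq_minmax (a b c d : nat) :
  perm_eq [:: a; b] [:: c; d] =
  ((minn a b, maxn a b) == (minn c d, maxn c d)).
Proof.
apply/idP/eqP => [eq_p|[eq_min eq_max]].
  have: a \in [:: c; d] by rewrite -(perm_mem eq_p) inE eqxx.
  rewrite !inE => /orP[] /eqP def_a; move: eq_p; rewrite {}def_a.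
    by rewrite perm_cons => /perm_consP[[|i]] [u] [] //=; case: u => // - [->].
  rewrite perm_sym (perm_catC [:: c] [:: d]) perm_cons.
  by move=> /perm_consP[[|i]] [u] [] //=; case: u => // - [->]; rewrite minnC maxnC.
have [[-> ->]//|[-> ->]] : (a = c /\ b = d) \/ (a = d /\ b = c) by lia.
by rewrite (perm_catC [:: d] [:: c]).
Qed.

(** [pmap] discards the undefined values, so injectivity is demanded only where [f] is defined. With
    [f] the label of an edge, edges with an uncolored end drop out. *)
Lemma uniq_pmapP (T S : eqType) (f : T -> option S) (r : seq T) : uniq r ->
  reflect {in r &, forall x y, f x -> f x = f y -> x = y} (uniq (pmap f r)).
Proof.
elim: r => [|x r IHr] /=; first by constructor.
case/andP=> x_r /IHr{}IHr; apply: (iffP idP) => [|inj_f].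
  move=> u y z; rewrite !inE => /predU1P[->|y_r] /predU1P[->|z_r] //.
  - case def_x: (f x) u => [a|] //= /andP[/negP a_r _] _ def_z; case: a_r.
    by rewrite mem_pmap def_z map_f.
  - case def_x: (f x) u => [a|] //=; last by move=> _ + def_y; rewrite def_y.
    move=> /andP[/negP a_r _] _ def_y; case: a_r.
    by rewrite mem_pmap -def_y map_f.
  apply: IHr => //; by case: (f x) u => [a|] //= /andP[].
have {}IHr : uniq (pmap f r).
  by apply/IHr=> y z y_r z_r; apply: inj_f; rewrite inE ?y_r ?z_r orbT.
case def_x: (f x) => [a|] //=; rewrite IHr andbT mem_pmap.
apply/mapP=> -[y y_r def_y]; case/negP: x_r.
by rewrite (inj_f x y) ?inE ?eqxx ?y_r ?orbT ?def_x.
Qed.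

(** * Positions on the cycle as sequences *)

Section CyclePositions.
Variables n k : nat.
Let C := cycle_graph n.+3.
Implicit Types (p : pcoloring C k) (i : 'I_n.+3).

Definition position_seq p : seq (option nat) :=
  [seq omap val (p i) | i <- enum 'I_n.+3].

Definition label_at p i := edge_label (omap val (p i), omap val (p (ordS i))).

(** Hence zipping a position with its rotation pairs each vertex with its successor, including the
    edge from the last vertex back to 0. *)
Lemma rot1_enum_ord : rot 1 (enum 'I_n.+3) = [seq ordS i | i <- enum 'I_n.+3].
Proof.
apply: (inj_map val_inj); rewrite map_rot val_enum_ord -(map_comp val (@ordS _)).
apply: (@eq_from_nth _ 0) => [|i].
  by rewrite size_rot size_iota size_map size_enum_ord.
rewrite size_rot size_iota => lt_i.
rewrite (nth_map ord0) ?size_enum_ord // [RHS]/= nth_enum_ord //.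
rewrite /rot nth_cat size_drop size_iota subn1 /=; case: ltnP => [lt_i'|ge_i].
  by rewrite -[_ :: _]/(iota 1 n.+2) nth_iota // add1n modn_small.
have ->: i = n.+2 by lia.
by rewrite subnn modnn.
Qed.

Lemma edge_labels_position p :
  edge_labels (position_seq p) = pmap (label_at p) (enum 'I_n.+3).
Proof.
rewrite /edge_labels /position_seq -map_rot rot1_enum_ord.
rewrite -(map_comp _ (@ordS _)) zip_map.
by elim: (enum _) => //= i r ->.
Qed.

(** Both labels must be defined: on a half-colored edge the multiset still records one color, while
    the label is [None]. *)
Lemma partial_edge_coloring_eq p i j :
    label_at p i -> label_at p j ->
  (partial_edge_coloring p (cycle_edge i) ==
   partial_edge_coloring p (cycle_edge j)) = (label_at p i == label_at p j).
Proof.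
rewrite /label_at /partial_edge_coloring.
have pmapE l : perm_eq (pmap p (enum (cycle_edge l))) (pmap p [:: l; ordS l]).
  by apply: perm_pmap; apply: perm_enum_cycle_edge.
have /eq_seq_msetP-> := pmapE i; have /eq_seq_msetP-> := pmapE j.
rewrite /=; case: (p i) (p (ordS i)) (p j) (p (ordS j)) => [a|] // [b|] //.
case=> [c|] // [d|] // _ _ /=.
(* Both labels are now of the form [Some], so their equality is convertible to that of the sorted
   pairs. *)
rewrite -[RHS]/(_ == _ :> nat * nat) -perm_eq_minmax.
rewrite -[RHS]/(perm_eq (map val [:: a; b]) (map val [:: c; d])).
apply/eqP/idP => [/eq_seq_msetP/(perm_map val)//|].
by move/(perm_map_inj val_inj)/eq_seq_msetP.
Qed.

Lemma label_atE p i : label_at p i = (cycle_edge i \subset colored p) :> bool.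
Proof.
rewrite /label_at subUset !sub1set !inE.
by case: (p i) => [a|]; case: (p (ordS i)).
Qed.

(** The induced edges are exactly those carrying a label, and [cycle_edge] is injective, so legality
    becomes a duplicate check on a list. *)
Lemma partial_edge_distinguishingE p :
  partial_edge_distinguishing p = uniq (edge_labels (position_seq p)).
Proof.
rewrite edge_labels_position.
apply/dinjectiveP/(uniq_pmapP _ (enum_uniq _)) => [inj_p i j _ _ li eq_ij|inj_p].
  have lj : label_at p j by rewrite -eq_ij.
  apply/cycle_edge_inj/inj_p.
  - by rewrite !inE -label_atE li edges_cycleE imset_f.
  - by rewrite !inE -label_atE lj edges_cycleE imset_f.
  by apply/eqP; rewrite partial_edge_coloring_eq // eq_ij.
move=> e1 e2; rewrite !inE edges_cycleE.
case/andP=> /imsetP[i _ ->]; rewrite -label_atE => li.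
case/andP=> /imsetP[j _ ->]; rewrite -label_atE => lj /eqP.
rewrite partial_edge_coloring_eq // => /eqP eq_ij.
by rewrite (inj_p i j) ?mem_enum.
Qed.

(** A total coloring is a partial one whose induced edges are all the edges. *)
Lemma edge_distinguishingE (c : coloring C k) :
  edge_distinguishing c =
  uniq (edge_labels [seq Some (val (c i)) | i <- enum 'I_n.+3]).
Proof.
pose p : pcoloring C k := [ffun i => Some (c i)].
have <- : position_seq p = [seq Some (val (c i)) | i <- enum 'I_n.+3].
  by apply: eq_map => i; rewrite ffunE.
rewrite -partial_edge_distinguishingE.
have eq_c e : partial_edge_coloring p e = induced_edge_coloring c e.
  congr seq_mset; elim: (enum _) => //= i r ->.
  by rewrite ffunE.
have eq_e : induced_edges (colored p) = edges C.
  apply/setP=> e; rewrite inE andb_idr // => _.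
  by apply/subsetP=> i _; rewrite inE ffunE.
by apply/dinjectiveP/dinjectiveP; rewrite eq_e => inj e1 e2 e1E e2E;
  [rewrite !eq_c | rewrite -!eq_c]; apply: inj.
Qed.

Lemma size_position_seq p : size (position_seq p) = n.+3.
Proof. by rewrite size_map size_enum_ord. Qed.

Lemma nth_position_seq p i : nth None (position_seq p) i = omap val (p i).
Proof. by rewrite (nth_map i) ?size_enum_ord // nth_ord_enum. Qed.

Lemma position_seq_color p (m : Defs.move C k) :
  position_seq (color_vertex p m) =
  set_nth None (position_seq p) (val m.1) (Some (val m.2)).
Proof.
have lt_m : val m.1 < n.+3 := ltn_ord m.1.
apply: (@eq_from_nth _ None) => [|j].
  by rewrite size_set_nth !size_position_seq (maxn_idPr lt_m).
rewrite size_position_seq => lt_j.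
rewrite -[j]/(val (Ordinal lt_j)) nth_position_seq ffunE nth_set_nth /=.
rewrite -[j]/(val (Ordinal lt_j)) val_eqE.
by case: (_ == _) => //; rewrite nth_position_seq.
Qed.

Definition successors (t : seq (option nat)) : seq (seq (option nat)) :=
  [seq t' <- [seq set_nth None t j (Some c)
             | j <- [seq j <- iota 0 (size t) | nth None t j == None],
               c <- iota 0 k]
     | uniq (edge_labels t')].

Lemma successorsP p t :
  reflect (exists2 m, legal_move p m & t = position_seq (color_vertex p m))
          (t \in successors (position_seq p)).
Proof.
rewrite mem_filter; apply: (iffP andP) => [[uniq_t /allpairsP[[i c] /=]]|].
  rewrite mem_filter !mem_iota size_position_seq /= !add0n.
  case=> /andP[free_i lt_i] lt_c def_t.
  pose m : Defs.move C k := (Ordinal lt_i, Ordinal lt_c).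
  have {}def_t : t = position_seq (color_vertex p m) by rewrite position_seq_color.
  exists m => //; rewrite /legal_move partial_edge_distinguishingE -def_t uniq_t.
  by move: free_i; rewrite -[i]/(val m.1) nth_position_seq; case: (p _).
case=> m /andP[/eqP free_m dist_m] ->; rewrite -partial_edge_distinguishingE.
split=> //; apply/allpairsP; exists (val m.1, val m.2); split=> /=.
- rewrite mem_filter nth_position_seq free_m mem_iota size_position_seq.
  exact: ltn_ord.
- by rewrite mem_iota /= add0n.
exact: position_seq_color.
Qed.

(** The recursion of [lost], with quantifiers over moves replaced by list traversals that can be
    evaluated. *)
Fixpoint lost_seq (d : nat) (t : seq (option nat)) : bool :=
  if d is d'.+1 then
    all (fun t' => has (lost_seq d') (successors t')) (successors t)
  else false.

Lemma lost_seqP d p : lost_seq d (position_seq p) -> lost d p.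
Proof.
elim: d p => // d IHd p /= /allP lost_p; apply/forallP=> m; apply/implyP=> legal_m.
have /hasP[t /successorsP[m' legal_m' ->] lost_t] :
    has (lost_seq d) (successors (position_seq (color_vertex p m))).
  by apply: lost_p; apply/successorsP; exists m.
by apply/existsP; exists m'; rewrite legal_m' IHd.
Qed.

Lemma position_seq_start : position_seq (start C k) = nseq n.+3 None.
Proof.
apply: (@eq_from_nth _ None) => [|j]; first by rewrite size_position_seq size_nseq.
rewrite size_position_seq => lt_j.
by rewrite -[j]/(val (Ordinal lt_j)) nth_position_seq ffunE nth_nseq if_same.
Qed.

Lemma mem_successors_start t :
  t \in successors (nseq n.+3 None) -> exists m', legal_move (start C k) m'.
Proof. by rewrite -position_seq_start => /successorsP[m' legal_m' _]; exists m'. Qed.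

End CyclePositions.

(** * The value of [lambda] on the 7-cycle, and the search *)

Definition sorted_pairs k : seq (nat * nat) :=
  [seq (a, b) | b <- iota 0 k, a <- iota 0 b.+1].

(* Pigeonhole on the unordered pairs of colors. *)
Lemma edge_distinguishable_cycle_geq n k :
  edge_distinguishable (cycle_graph n.+3) k -> n.+3 <= size (sorted_pairs k).
Proof.
case/andP=> _ /existsP[c]; rewrite edge_distinguishingE => uniq_c.
set p := [seq Some _ | _ <- _] in uniq_c.
pose q : pcoloring (cycle_graph n.+3) k := [ffun i => Some (c i)].
have def_p : position_seq q = p by apply: eq_map => i; rewrite ffunE.
have <- : size (edge_labels p) = n.+3.
  rewrite -def_p edge_labels_position size_pmap -[RHS]size_enum_ord.
  by apply/eqP; rewrite -all_count; apply/allP=> i _; rewrite /label_at !ffunE.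
apply: uniq_leq_size => // ab.
rewrite -def_p edge_labels_position mem_pmap => /mapP[i _].
rewrite /label_at !ffunE /= => -[->]; apply/allpairsPdep.
exists (maxn (c i) (c (ordS i))), (minn (c i) (c (ordS i))).
have := ltn_ord (c i); have := ltn_ord (c (ordS i)).
by rewrite !mem_iota /= => ? ?; split=> //; lia.
Qed.

Lemma lambda_cycle7 : lambda (cycle_graph 7) = 4.
Proof.
rewrite /lambda; case: ex_minnP => k dist_k min_k; apply/eqP; rewrite eqn_leq.
apply/andP; split.
  apply/min_k/existsP.
  (* The labels are 00, 01, 11, 12, 22, 23 and 03. *)
  exists [ffun i : 'I_7 => inord (nth 0 [:: 0; 0; 1; 1; 2; 2; 3] i)].
  rewrite edge_distinguishingE.
  rewrite (_ : map _ _ = [seq Some j | j <- [:: 0; 0; 1; 1; 2; 2; 3]]) //.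
  rewrite -[in RHS](mkseq_nth 0 [:: 0; 0; 1; 1; 2; 2; 3]) /mkseq -val_enum_ord.
  rewrite -!map_comp; apply: eq_map => i /=; congr Some.
  by rewrite ffunE inordK //; case: i => -[|[|[|[|[|[|[|]]]]]]].
(* For [k] = 0, 1, 2, 3 there are 0, 1, 3, 6 sorted pairs, fewer than seven. *)
move/edge_distinguishable_cycle_geq: dist_k.
by case: k {min_k} => [|[|[|[|k]]]].
Qed.

(* Lazy evaluation short-circuits [all] and [has]; call by value would visit
   the whole game tree. *)
Lemma lost_seq_start : lost_seq 4 4 (nseq 7 None).
Proof. by lazy. Qed.

Theorem theorem3p16 : EDGe_has_winning_strategy (cycle_graph 7) Player2.
Proof.
rewrite /EDGe_has_winning_strategy lambda_cycle7.
have [m0 legal_m0] : exists m, legal_move (start (cycle_graph 7) 4) m.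
  (* The opening colors vertex 0 with color 0. The first 4 is 7 - 3, the second is the number of
     colors. *)
  exact: (@mem_successors_start 4 4 (Some 0 :: nseq 6 None)).
(* Seven vertices allow at most three full rounds; a fourth level is needed because depth 0 is never
   lost. *)
apply: (lost_start_winning_strategy (n := 4) legal_m0).
by apply: lost_seqP; rewrite position_seq_start lost_seq_start.
Qed.
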